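(* (a) There is a subgroup of $\mathrm{Aut}(\widetilde T_9)_\omega$ without the Haagerup property that acts vertex transitively on $\widetilde T_9$ and whose closure is a scale group. (b) There is a subgroup of $\mathrm{Aut}(\widetilde T_5)_\omega$ without the Haagerup property that acts vertex transitively on $\widetilde T_5$ and whose closure is a scale group.
   Context: $\widetilde T_{d+1}$ is the $(d+1)$-regular tree; an end is an equivalence class of infinite geodesic rays (equivalent if they eventually coincide), $\omega$ is a fixed end, and $\mathrm{Aut}(\widetilde T_{d+1})_\omega$ is the group of automorphisms of $\widetilde T_{d+1}$ fixing $\omega$, with the topology of pointwise convergence on vertices. A scale group is a closed vertex-transitive subgroup of $\mathrm{Aut}(\widetilde T_{d+1})$ fixing an end. A (discrete) group has the Haagerup property (is a-T-menable) if it admits a proper affine isometric action on a Hilbert space; here the subgroups in question are considered as discrete groups. *)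

(* Defs.v *)
From HB Require Import structures.
From mathcomp Require Import all_boot all_order all_algebra sesquilinear.
From mathcomp Require Import all_classical all_reals all_analysis.

Set Implicit Arguments.
Unset Strict Implicit.
Unset Printing Implicit Defensive.

Import Order.TTheory GRing.Theory Num.Theory.
Import numFieldNormedType.Exports.

Local Open Scope classical_set_scope.
Local Open Scope ring_scope.

(** * Regular trees, with a simple graph given by its adjacency relation *)

Section Trees.
Variables (V : choiceType) (e : rel V).

Definition walk (x y : V) (p : seq V) : Prop := path e x p /\ last x p = y.

(* [ucycle e c] says that [c] is a closed walk without repeated vertices; the
   bound on the size discards single vertices and edges travelled twice. *)
Definition is_tree : Prop :=
  [/\ inhabited V, symmetric e, irreflexive e,
      forall x y, exists p, walk x y p
    & forall c : seq V, (2 < size c)%N -> ~ ucycle e c].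

Definition regular_tree (k : nat) : Prop :=
  is_tree /\ forall x, ([set y | e x y] #= `I_k)%card.

Definition distance (x y : V) (n : nat) : Prop :=
  (exists2 p, walk x y p & size p = n) /\
  (forall p, walk x y p -> (n <= size p)%N).

Definition geodesic_ray (r : nat -> V) : Prop :=
  forall m n : nat, (m <= n)%N -> distance (r m) (r n) (n - m).

(* The shifts are independent: rays with different origins may coincide
   eventually as subsets of the tree. *)
Definition ray_equiv (r s : nat -> V) : Prop :=
  exists m n : nat, forall k : nat, r (m + k)%N = s (n + k)%N.

Definition is_end (w : set (nat -> V)) : Prop :=
  exists2 r, geodesic_ray r & w = [set s | geodesic_ray s /\ ray_equiv r s].

End Trees.

(** * The automorphism group of a graph *)

Record aut (V : choiceType) (e : rel V) := Aut {
  aut_fun :> V -> V;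
  aut_bij : bijective aut_fun;
  aut_mono : {mono aut_fun : x y / e x y} }.

HB.instance Definition _ (V : choiceType) (e : rel V) :=
  gen_eqMixin (aut e).
HB.instance Definition _ (V : choiceType) (e : rel V) :=
  gen_choiceMixin (aut e).

Section AutGroup.
Variables (V : choiceType) (e : rel V).
Implicit Types f g : aut e.

Lemma aut_eqP f g : f =1 g -> f = g.
Proof.
case: f g => [f fb fm] [g gb gm] /= /funext fg; subst g.
by congr Aut; exact: Prop_irrelevance.
Qed.

Definition aut_one : aut e :=
  @Aut V e id (Bijective (fun=> erefl) (fun=> erefl)) (fun _ _ => erefl).

Lemma aut_mul_mono f g : {mono f \o g : x y / e x y}.
Proof. by move=> x y /=; rewrite !aut_mono. Qed.

Definition aut_mul f g : aut e :=
  Aut (bij_comp (aut_bij f) (aut_bij g)) (aut_mul_mono f g).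

Lemma aut_inv_ex f : exists g : aut e, cancel f g /\ cancel g f.
Proof.
have [g fK gK] := aut_bij f.
have gm : {mono g : x y / e x y} by move=> x y; rewrite -(aut_mono f) !gK.
by exists (Aut (Bijective gK fK) gm).
Qed.

Definition aut_inv f : aut e := projT1 (cid (aut_inv_ex f)).

Lemma aut_invK f : cancel f (aut_inv f) /\ cancel (aut_inv f) f.
Proof. exact: (projT2 (cid (aut_inv_ex f))). Qed.

Lemma aut_mulA : associative aut_mul.
Proof. by move=> f g h; exact: aut_eqP. Qed.

Lemma aut_mul1 : left_id aut_one aut_mul.
Proof. by move=> f; exact: aut_eqP. Qed.

Lemma aut_mulr1 : right_id aut_one aut_mul.
Proof. by move=> f; exact: aut_eqP. Qed.

Lemma aut_mulV : left_inverse aut_one aut_inv aut_mul.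
Proof. by move=> f; apply: aut_eqP => x /=; rewrite (aut_invK f).1. Qed.

Lemma aut_mulrV : right_inverse aut_one aut_inv aut_mul.
Proof. by move=> f; apply: aut_eqP => x /=; rewrite (aut_invK f).2. Qed.

HB.instance Definition _ := isGroup.Build (aut e)
  aut_mulA aut_mul1 aut_mulr1 aut_mulV aut_mulrV.

End AutGroup.

(* Pointwise convergence on vertices, the vertex set being discrete. *)
HB.instance Definition _ (V : choiceType) (e : rel V) :=
  Topological.copy (aut e)
    (initial_topology (@aut_fun V e : aut e -> {ptws V -> discrete_topology V})).

Definition is_subgroup (G : groupType) (H : set G) : Prop :=
  [/\ H 1%g, forall g h, H g -> H h -> H (g * h)%g
    & forall g, H g -> H (g^-1)%g].

Section ScaleGroups.
Variables (V : choiceType) (e : rel V).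
Implicit Types (w : set (nat -> V)) (H : set (aut e)).

Definition aut_end w : set (aut e) :=
  [set g | [set (g : V -> V) \o r | r in w] = w].

Definition vertex_transitive H : Prop :=
  forall x y : V, exists2 g : aut e, H g & g x = y.

Definition scale_group H : Prop :=
  [/\ is_subgroup H, closed H, vertex_transitive H
    & exists2 w, is_end e w & H `<=` aut_end w].

End ScaleGroups.

(** * The Haagerup property of a discrete group *)

(* A real Hilbert space is a Banach space whose norm comes from an inner
   product. *)
Definition hilbert_norm (R : realType) (E : completeNormedModType R)
    (dot : {dot E for idfun}) : Prop :=
  forall x : E, `|x| ^+ 2 = dot x x.

(* The action [a] is only meaningful on [H]. *)
Definition affine_isometric_action (R : realType) (G : groupType) (H : set G)
    (E : normedModType R) (a : G -> E -> E) : Prop :=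
  [/\ forall x, a 1%g x = x,
      forall g h, H g -> H h -> forall x, a (g * h)%g x = a g (a h x)
    & forall g, H g -> exists (u : {linear E -> E}) (b : E),
        (forall x, `|u x| = `|x|) /\ (forall x, a g x = u x + b)].

(* Metric properness for the discrete topology on [H]: only finitely many
   elements of [H] move a given ball to a set that meets this ball. *)
Definition proper_action (R : realType) (G : groupType) (H : set G)
    (E : normedModType R) (a : G -> E -> E) : Prop :=
  forall r : R,
    finite_set [set g | H g /\ exists2 x : E, `|x| <= r & `|a g x| <= r].

(* The property of the subgroup [H] taken as an abstract discrete group: the
   topology that [G] may carry plays no role.  As finiteness of the sets in
   [proper_action] makes [H] countable, the notion is of interest for
   countable [H] only. *)
Definition haagerup (R : realType) (G : groupType) (H : set G) : Prop :=
  exists (E : completeNormedModType R) (dot : {dot E for idfun})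
         (a : G -> E -> E),
    [/\ hilbert_norm dot, affine_isometric_action H a & proper_action H a].

(* Main.v *)
Require Import Defs.
From HB Require Import structures.
From mathcomp Require Import all_boot all_order all_algebra sesquilinear.
From mathcomp Require Import all_classical all_reals all_analysis.
From mathcomp Require Import lra zify.

(* Read the tree from the end: vertices become pairs of a height h and a finitely
   supported sequence of labels on [h, +oo[ with values in a group L of order 4 or
   8, and every causal operator on sequences acts by automorphisms fixing the end.
   Translations by sequences and shifts are transitive. For L = F_2^2 x L', the
   translations contain A = F_2[t]^2, on which the shears (p, q) -> (p, q + p),
   (p, q + t p) and the swap of coordinates act by causal operators as well.

   The group generated by these is not Haagerup, because A has bounded orbits in
   every affine isometric action. Let xi be a fixed point of a finite subgroup of A,
   decompose it into isotypic components, and distribute the squared norm according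
   to the lowest degrees a and b at which the two coordinates of a character of A
   are nontrivial, into masses b1 (a < b), b2 (b < a), b3 (a = b). The swap, the
   first and the second shear move xi by a bounded amount up to invariant vectors
   and permute these spectral sets, which yields, up to factors close to 1 and
   additive constants, b1 <= b2, b2 <= b3 and b2 + b3 <= b1. Hence all three are
   bounded independently of the finite subgroup. *)

Set Implicit Arguments.
Unset Strict Implicit.
Unset Printing Implicit Defensive.

Import Order.TTheory GRing.Theory Num.Theory.
Import numFieldNormedType.Exports.

Local Open Scope classical_set_scope.
Local Open Scope ring_scope.

(** * Spectral masses for commuting isometric involutions *)

Section Halves.
Variables (R : realType) (E : normedModType R).
Implicit Types (f g : {linear E -> E}) (v w : E).

(** For an isometric involution [f] of a Hilbert space, these are the orthogonal projections onto
    its eigenspaces for 1 and -1. *)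
Definition plus_half f v := 2^-1 *: (v + f v).
Definition minus_half f v := 2^-1 *: (v - f v).

Lemma plus_halfE f v : plus_half f v = 2^-1 *: (v + f v). Proof. by []. Qed.
Lemma minus_halfE f v : minus_half f v = 2^-1 *: (v - f v). Proof. by []. Qed.

Fact plus_half_linear f : linear (plus_half f).
Proof. exact: linearP (2^-1 \*: (idfun \+ f)). Qed.

Fact minus_half_linear f : linear (minus_half f).
Proof. exact: linearP (2^-1 \*: (idfun \- f)). Qed.

HB.instance Definition _ f :=
  GRing.isLinear.Build R E E *:%R (plus_half f) (plus_half_linear f).
HB.instance Definition _ f :=
  GRing.isLinear.Build R E E *:%R (minus_half f) (minus_half_linear f).

Lemma half_addrr v : 2^-1 *: (v + v) = v.
Proof. by rewrite -mulr2n -(scaler_nat 2 v) scalerA mulVf ?scale1r // pnatr_eq0. Qed.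

Lemma plus_half_id f v : f v = v -> plus_half f v = v.
Proof. by move=> fv; rewrite plus_halfE fv half_addrr. Qed.

Lemma minus_half_id f v : f v = v -> minus_half f v = 0.
Proof. by move=> fv; rewrite minus_halfE fv subrr scaler0. Qed.

Lemma plus_half_swap (u : {linear E -> E}) f g v :
  f (u v) = u (g v) -> plus_half f (u v) = u (plus_half g v).
Proof. by move=> h; rewrite !plus_halfE h -linearD -linearZ. Qed.

Lemma minus_half_swap (u : {linear E -> E}) f g v :
  f (u v) = u (g v) -> minus_half f (u v) = u (minus_half g v).
Proof. by move=> h; rewrite !minus_halfE h -linearB -linearZ. Qed.

(** The sign exchanges the two eigenspaces; this is how a shear carries one spectral set to
    another. *)
Lemma minus_half_swapN (u : {linear E -> E}) f g v :
  f (u v) = - u (g v) -> minus_half f (u v) = u (plus_half g v).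
Proof.
by move=> h; rewrite minus_halfE h opprK -linearD -linearZ.
Qed.

Lemma plus_half_swapN (u : {linear E -> E}) f g v :
  f (u v) = - u (g v) -> plus_half f (u v) = u (minus_half g v).
Proof. by move=> h; rewrite plus_halfE h -linearB -linearZ. Qed.

Lemma plus_half_fix f v : involutive f -> f (plus_half f v) = plus_half f v.
Proof. by move=> fK; rewrite plus_halfE linearZ /= linearD fK addrC. Qed.

Lemma minus_half_anti f v : involutive f -> f (minus_half f v) = - minus_half f v.
Proof.
by move=> fK; rewrite minus_halfE linearZ /= linearB fK -scalerN opprB.
Qed.

Hypothesis parallelogram : forall v w : E,
  `|v + w| ^+ 2 + `|v - w| ^+ 2 = 2 * (`|v| ^+ 2 + `|w| ^+ 2).

Lemma minus_halfD f : {morph minus_half f : v w / v + w}.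
Proof. exact: linearD. Qed.

(** The parallelogram law for [v] and [f v], which have equal norms. *)
Lemma half_pythagoras f v : (forall v, `|f v| = `|v|) ->
  `|v| ^+ 2 = `|plus_half f v| ^+ 2 + `|minus_half f v| ^+ 2.
Proof.
move=> fn; rewrite plus_halfE minus_halfE !normrZ !exprMn -mulrDr.
rewrite parallelogram fn ger0_norm ?invr_ge0 //.
by have := sqr_ge0 `|v|; lra.
Qed.

Lemma norm_minus_half f v : (forall v, `|f v| = `|v|) ->
  `|minus_half f v| ^+ 2 <= `|v| ^+ 2.
Proof. by move=> fn; rewrite [leRHS](half_pythagoras _ fn) lerDr sqr_ge0. Qed.

(* AM-GM, with a weight close enough to 1 for the contraction argument below. *)
Lemma normD_sqr v w : `|v + w| ^+ 2 <= 5/4 * `|v| ^+ 2 + 5 * `|w| ^+ 2.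
Proof.
have := ler_normD v w; have := normr_ge0 (v + w).
have := normr_ge0 v; have := normr_ge0 w.
move: `|v| `|w| `|v + w| => a b c *.
have: c ^+ 2 <= (a + b) ^+ 2 by rewrite ler_sqr ?nnegrE ?addr_ge0.
have := sqr_ge0 (a - 4 * b); nra.
Qed.

Variables X Y : nat -> {linear E -> E}.
Hypotheses (Xn : forall k v, `|X k v| = `|v|) (Yn : forall k v, `|Y k v| = `|v|).
Hypotheses (XK : forall k, involutive (X k)) (YK : forall k, involutive (Y k)).
Hypotheses (XX : forall i j v, X i (X j v) = X j (X i v))
  (XY : forall i j v, X i (Y j v) = Y j (X i v)).

Fixpoint fixed_part k : {linear E -> E} :=
  if k is j.+1 then plus_half (X j) \o (plus_half (Y j) \o fixed_part j)
  else idfun.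

(* In terms of characters of the group generated by the [X i] and [Y i]: let [a]
   and [b] be the least indices at which [X], resp. [Y], takes the value -1.
   Then [part1 k], [part2 k], [part3 k] are the spectral projections on
   a = k < b, b = k < a, a = b = k. *)
Definition part1 k : {linear E -> E} :=
  minus_half (X k) \o (plus_half (Y k) \o fixed_part k).
Definition part2 k : {linear E -> E} :=
  plus_half (X k) \o (minus_half (Y k) \o fixed_part k).
Definition part3 k : {linear E -> E} :=
  minus_half (X k) \o (minus_half (Y k) \o fixed_part k).

Lemma fixed_part_commute (g : {linear E -> E}) k v :
  (forall i v, X i (g v) = g (X i v)) -> (forall i v, Y i (g v) = g (Y i v)) ->
  fixed_part k (g v) = g (fixed_part k v).
Proof.
move=> gX gY; elim: k => //= k IH.
by rewrite IH (plus_half_swap (gY _ _)) (plus_half_swap (gX _ _)).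
Qed.

Lemma parts_commute (g : {linear E -> E}) k v :
  (forall i v, X i (g v) = g (X i v)) -> (forall i v, Y i (g v) = g (Y i v)) ->
  [/\ part1 k (g v) = g (part1 k v), part2 k (g v) = g (part2 k v)
    & part3 k (g v) = g (part3 k v)].
Proof.
move=> gX gY; rewrite /part1 /part2 /part3 /= fixed_part_commute //.
by rewrite !(plus_half_swap (gY _ _)) !(minus_half_swap (gY _ _))
  !(plus_half_swap (gX _ _)) !(minus_half_swap (gX _ _)).
Qed.

Lemma plus_half_commute (f g : {linear E -> E}) :
  (forall v, f (g v) = g (f v)) ->
  forall v, f (plus_half g v) = plus_half g (f v).
Proof.
by move=> fg v; rewrite !plus_halfE linearZ /= linearD fg.
Qed.

Lemma minus_half_commute (f g : {linear E -> E}) :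
  (forall v, f (g v) = g (f v)) ->
  forall v, f (minus_half g v) = minus_half g (f v).
Proof.
by move=> fg v; rewrite !minus_halfE linearZ /= linearB fg.
Qed.

Lemma plus_plus i j v :
  plus_half (X i) (plus_half (Y j) v) = plus_half (Y j) (plus_half (X i) v).
Proof. by apply: plus_half_swap; rewrite plus_half_commute. Qed.

Lemma plus_minus i j v :
  plus_half (X i) (minus_half (Y j) v) = minus_half (Y j) (plus_half (X i) v).
Proof. by apply: plus_half_swap; rewrite minus_half_commute. Qed.

Lemma minus_minus i j v :
  minus_half (X i) (minus_half (Y j) v) = minus_half (Y j) (minus_half (X i) v).
Proof. by apply: minus_half_swap; rewrite minus_half_commute. Qed.

Lemma fixed_part_id n v :
  (forall i, (i < n)%N -> X i v = v) -> (forall i, (i < n)%N -> Y i v = v) ->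
  fixed_part n v = v.
Proof.
elim: n => //= n IH Xv Yv.
rewrite IH; [|by move=> i /ltnW/Xv | by move=> i /ltnW/Yv].
by rewrite !plus_half_id ?Xv ?Yv.
Qed.

(** Hence the parts with index below [n] see a vector only modulo the vectors fixed by all [X i] and
    [Y i] with [i < n]. *)
Lemma parts_eq0 n k v : (k < n)%N ->
  (forall i, (i < n)%N -> X i v = v) -> (forall i, (i < n)%N -> Y i v = v) ->
  [/\ part1 k v = 0, part2 k v = 0 & part3 k v = 0].
Proof.
move=> kn Xv Yv; have Zv : fixed_part k v = v.
  by apply: fixed_part_id => i ik; [apply: Xv|apply: Yv]; apply: ltn_trans kn.
rewrite /part1 /part2 /part3 /= Zv (plus_half_id (Yv _ kn)).
by rewrite (minus_half_id (Yv _ kn)) (minus_half_id (Xv _ kn)) !linear0.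
Qed.

(** In terms of characters, the left side lives on b = k <= a, which [X k] splits into k < a and k =
    a. *)
Lemma parts23_pythagoras k v :
  `|minus_half (Y k) (fixed_part k v)| ^+ 2
  = `|part2 k v| ^+ 2 + `|part3 k v| ^+ 2.
Proof. exact: half_pythagoras. Qed.

Lemma fixed_part_pythagoras k v :
  `|fixed_part k v| ^+ 2 = `|fixed_part k.+1 v| ^+ 2 + `|part1 k v| ^+ 2
    + `|part2 k v| ^+ 2 + `|part3 k v| ^+ 2.
Proof.
rewrite (half_pythagoras _ (Yn k)) parts23_pythagoras addrA.
by rewrite (half_pythagoras (plus_half (Y k) _) (Xn k)).
Qed.

Definition mass (T : nat -> {linear E -> E}) n v :=
  \sum_(0 <= k < n) `|T k v| ^+ 2.

Lemma mass_decomposition n v : `|v| ^+ 2 =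
  `|fixed_part n v| ^+ 2 + mass part1 n v + mass part2 n v + mass part3 n v.
Proof.
rewrite /mass; elim: n => [|n IH]; first by rewrite !big_nil !addr0.
rewrite {}IH !big_nat_recr //= fixed_part_pythagoras /=; lra.
Qed.

Lemma mass_ge0 T n v : 0 <= mass T n v.
Proof. by apply: sumr_ge0 => k _; exact: sqr_ge0. Qed.

Lemma mass_le n v : [/\ mass part1 n v <= `|v| ^+ 2, mass part2 n v <= `|v| ^+ 2
  & mass part3 n v <= `|v| ^+ 2].
Proof.
have := mass_decomposition n v; have := mass_ge0 part1 n v.
have := mass_ge0 part2 n v; have := mass_ge0 part3 n v.
by have := sqr_ge0 `|fixed_part n v|; split; lra.
Qed.

Lemma mass_compare (S T : nat -> {linear E -> E}) n v b :
  (forall k, (k < n)%N ->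
    `|S k v| ^+ 2 <= 5/4 * `|T k v| ^+ 2 + 5 * `|S k b| ^+ 2) ->
  mass S n v <= 5/4 * mass T n v + 5 * mass S n b.
Proof.
move=> h; rewrite /mass !big_distrr /= -big_split /= !big_mkord.
by apply: ler_sum => k _; exact: h.
Qed.

(* The isometry [u] intertwines [part2] with [part1], while the affine map
   [z |-> u z + b] moves [v] by a vector on which the parts vanish. *)
Lemma swap_mass (u : {linear E -> E}) n v b :
  (forall v, `|u v| = `|v|) ->
  (forall k v, X k (u v) = u (Y k v)) -> (forall k v, Y k (u v) = u (X k v)) ->
  (forall k, (k < n)%N -> part1 k (u v + b) = part1 k v) ->
  mass part1 n v <= 5/4 * mass part2 n v + 5 * `|b| ^+ 2.
Proof.
move=> un uX uY fixv.
have Zu k w : fixed_part k (u w) = u (fixed_part k w).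
  elim: k => //= k ->; rewrite (plus_half_swap (uY _ _)) (plus_half_swap (uX _ _)).
  by rewrite plus_plus.
have h k w : part1 k (u w) = u (part2 k w).
  rewrite /part1 /part2 /= Zu (plus_half_swap (uY _ _)) (minus_half_swap (uX _ _)).
  by rewrite plus_minus.
apply: le_trans (_ : _ <= 5/4 * mass part2 n v + 5 * mass part1 n b) _.
  apply: mass_compare => k kn; rewrite -fixv // linearD h.
  by apply: le_trans (normD_sqr _ _) _; rewrite un.
by rewrite lerD2l ler_pM2l //; case: (mass_le n b).
Qed.

(** On a character with b = k < a, multiplying each [X i] by [Y i] changes nothing below k and turns
    the value of [X k] into -1. So [u] carries [part2 k] to [part3 k]. *)
Lemma shear0_mass (u : {linear E -> E}) n v b :
  (forall v, `|u v| = `|v|) ->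
  (forall k v, X k (u v) = u (X k (Y k v))) -> (forall k v, Y k (u v) = u (Y k v)) ->
  (forall k, (k < n)%N -> part3 k (u v + b) = part3 k v) ->
  mass part2 n v <= 5/4 * mass part3 n v + 5 * `|b| ^+ 2.
Proof.
move=> un uX uY fixv.
have Zu k w : fixed_part k (u w) = u (fixed_part k w).
  elim: k => //= k ->; rewrite (plus_half_swap (uY _ _)).
  (* On the image of [plus_half (Y k)] the extra factor [Y k] is trivial; in the next step it acts
     as -1 and exchanges the two halves of [X k]. *)
  by rewrite (plus_half_swap (g := X k)) // uX plus_half_fix.
have h k w : part3 k (u w) = u (part2 k w).
  rewrite /part3 /part2 /= Zu (minus_half_swap (uY _ _)).
  by rewrite (minus_half_swapN (g := X k)) // uX minus_half_anti // !linearN.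
apply: le_trans (_ : _ <= 5/4 * mass part3 n v + 5 * mass part3 n b) _; last first.
  by rewrite lerD2l ler_pM2l //; case: (mass_le n b).
rewrite /mass !big_distrr /= -big_split /= !big_mkord.
apply: ler_sum => -[k kn] _ /=; rewrite -un -h -(addrK b (u v)) linearB fixv //.
by apply: le_trans (normD_sqr _ _) _; rewrite normrN.
Qed.

(** Multiplying each [X i] by [Y i.+1] exchanges the characters with b = k + 1 <= a and those with a
    = k, b = k + 1. The latter lie in [part1 k]. The characters with b = 0 are not reached and
    account for the last term. *)
Lemma shear1_mass (u : {linear E -> E}) n v b :
  (forall v, `|u v| = `|v|) ->
  (forall k v, X k (u v) = u (X k (Y k.+1 v))) ->
  (forall k v, Y k (u v) = u (Y k v)) ->
  (forall k, (k < n)%N -> part2 k (u v + b) = part2 k v) ->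
  (forall k, (k < n)%N -> part3 k (u v + b) = part3 k v) ->
  mass part2 n v + mass part3 n v
  <= 5/4 * mass part1 n v + 10 * `|b| ^+ 2 + `|minus_half (Y 0) v| ^+ 2.
Proof.
move=> un uX uY fix2 fix3.
(* [W k] projects on k <= a, k < b. Unlike the set of [fixed_part k], this one is preserved by [u],
   because [X i] with [i < k] picks up [Y i.+1], which may be [Y k]. *)
pose W k : {linear E -> E} := plus_half (Y k) \o fixed_part k.
have Wu k w : W k (u w) = u (W k w).
  elim: k => [|k IH]; first by rewrite /W /= (plus_half_swap (uY _ _)).
  have WS z : W k.+1 z = plus_half (X k) (plus_half (Y k.+1) (W k z)).
    exact: (esym (plus_plus _ _ _)).
  rewrite !WS IH (plus_half_swap (uY _ _)) (plus_half_swap (g := X k)) //.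
  by rewrite uX plus_half_fix.
have h k w : minus_half (Y k.+1) (fixed_part k.+1 (u w))
           = u (minus_half (Y k.+1) (part1 k w)).
  rewrite -[fixed_part _ _]/(plus_half (X k) (W k (u w))) Wu -plus_minus.
  rewrite (minus_half_swap (uY _ _)) (plus_half_swapN (g := X k)).
    by rewrite minus_minus.
  by rewrite uX minus_half_anti // !linearN.
have fix23 k : (k < n)%N ->
    minus_half (Y k) (fixed_part k (u v + b)) = minus_half (Y k) (fixed_part k v).
  move=> kn; apply/eqP; rewrite -subr_eq0 -!linearB /=.
  have := parts23_pythagoras k (u v + b - v).
  rewrite !linearB fix2 // fix3 // !subrr normr0 expr0n /= addr0.
  by move/eqP; rewrite sqrf_eq0 normr_eq0.
rewrite /mass -big_split /=; case: n fix23 {fix2 fix3} => [|n] fix23.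
  by rewrite !big_nil mulr0 add0r addr_ge0 ?mulr_ge0 ?sqr_ge0.
under eq_bigr do rewrite -parts23_pythagoras.
(* The term of index 0 is the one with [Y 0]; the others are shifted by one to be compared with
   [part1]. *)
rewrite big_nat_recl // [leLHS]addrC lerD2r.
apply: le_trans (_ : _ <= \sum_(0 <= k < n) (5/4 * `|part1 k v| ^+ 2 +
    5 * (`|part2 k.+1 b| ^+ 2 + `|part3 k.+1 b| ^+ 2))) _.
  rewrite !big_mkord; apply: ler_sum => -[k kn] _.
  rewrite -fix23 // linearD minus_halfD h -parts23_pythagoras.
  apply: le_trans (normD_sqr _ _) _; rewrite un lerD2r ler_pM2l //.
  exact: norm_minus_half.
have [_ m2 m3] := mass_le n.+1 b.
rewrite /mass !big_nat_recl //= in m2 m3.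
rewrite big_split /= -!big_distrr /= big_split /= big_nat_recr //=.
have := sqr_ge0 `|part1 n v|; have := sqr_ge0 `|part2 0 b|.
have := sqr_ge0 `|part3 0 b|.
move: (\sum_(_ <= _ < _) `|part2 _.+1 _| ^+ 2) m2.
move: (\sum_(_ <= _ < _) `|part3 _.+1 _| ^+ 2) m3.
move=> *; lra.
Qed.

(** The projected vector has no component fixed by [X j], so its squared norm is all mass; and the
    projection commutes with the parts and does not increase norms. *)
Lemma displacement_mass n j v : (j < n)%N ->
  `|minus_half (X j) v| ^+ 2 <= mass part1 n v + mass part2 n v + mass part3 n v.
Proof.
move=> jn; pose w := minus_half (X j) v.
have comX i z : X i (minus_half (X j) z) = minus_half (X j) (X i z).
  exact: minus_half_commute.
have comY i z : Y i (minus_half (X j) z) = minus_half (X j) (Y i z).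
  by apply: minus_half_commute => ?; rewrite XY.
have Z0 : fixed_part n w = 0.
  rewrite -(subnK jn); elim: (n - _)%N => [|i IH]; last by rewrite /= IH !linear0.
  rewrite add0n fixed_part_commute //= minus_half_id // plus_half_fix //.
rewrite (mass_decomposition n w) Z0 normr0 expr0n add0r.
have [le1 le2 le3] : [/\ mass part1 n w <= mass part1 n v,
    mass part2 n w <= mass part2 n v & mass part3 n w <= mass part3 n v].
  rewrite /mass !big_mkord; split; apply: ler_sum => k _;
  have [h1 h2 h3] := parts_commute k v comX comY;
  rewrite ?h1 ?h2 ?h3; exact: norm_minus_half.
by rewrite !lerD.
Qed.

End Halves.

(** * Affine actions of the shear group *)

Lemma hilbert_parallelogram (R : realType) (E : completeNormedModType R)
    (dot : {dot E for idfun}) : hilbert_norm dot -> forall v w : E,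
  `|v + w| ^+ 2 + `|v - w| ^+ 2 = 2 * (`|v| ^+ 2 + `|w| ^+ 2).
Proof.
move=> dotE v w; rewrite !dotE mulrDr linearBl !linearBr linearDl !linearDr; lra.
Qed.

(** Induction on [s]: if [v] is fixed by the tail, the midpoint of [v] and [a g v] is fixed by the
    involution [g], and still by the tail because [g] commutes with it. *)
Lemma affine_commuting_fixpoint (R : realType) (E : normedModType R)
    (G : groupType) (H : set G) (a : G -> E -> E) (s : seq G) :
  affine_isometric_action H a ->
  (forall g, g \in s -> H g /\ (g * g = 1)%g) ->
  (forall g h, g \in s -> h \in s -> (g * h = h * g)%g) ->
  exists v, forall g, g \in s -> a g v = v.
Proof.
move=> [a1 aM aA]; elim: s => [|g s IH] sH sC; first by exists 0.
have [||v vP] := IH.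
- by move=> h hs; apply: sH; rewrite inE hs orbT.
- by move=> h k hs ks; apply: sC; rewrite inE ?hs ?ks orbT.
have [Hg gg] := sH g (mem_head _ _).
have mid h : H h -> a h (2^-1 *: (v + a g v)) = 2^-1 *: (a h v + a h (a g v)).
  move=> /aA[u [b [_ ub]]]; rewrite !ub linearZ linearD /=.
  by rewrite addrACA [in RHS]scalerDr half_addrr.
exists (2^-1 *: (v + a g v)) => h; rewrite inE => /predU1P[->|hs].
  by rewrite mid // -aM // gg a1 addrC.
have hs' : h \in g :: s by rewrite inE hs orbT.
have [Hh _] := sH h hs'.
by rewrite mid // -aM // sC ?mem_head // aM // vP.
Qed.

(* The relations say that [x] and [y] generate an elementary abelian group which
   is F_2[t]^2 with x_k = (t^k, 0) and y_k = (0, t^k), and on which [u0], [u1]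
   and [r] act as the shears (p, q) |-> (p, q + p), (p, q + t p) and as the swap. *)
Lemma shear_group_not_haagerup (R : realType) (G : groupType) (H : set G)
    (x y : nat -> G) (u0 u1 r : G) :
  is_subgroup H -> (forall k, H (x k)) -> (forall k, H (y k)) ->
  H u0 -> H u1 -> H r -> injective x ->
  (forall k, x k * x k = 1)%g -> (forall k, y k * y k = 1)%g ->
  (forall i j, x i * x j = x j * x i)%g ->
  (forall i j, y i * y j = y j * y i)%g ->
  (forall i j, x i * y j = y j * x i)%g ->
  (forall k, x k * u0 = u0 * (x k * y k))%g -> (forall k, y k * u0 = u0 * y k)%g ->
  (forall k, x k * u1 = u1 * (x k * y k.+1))%g ->
  (forall k, y k * u1 = u1 * y k)%g ->
  (forall k, x k * r = r * y k)%g -> (forall k, y k * r = r * x k)%g ->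
  ~ haagerup R H.
Proof.
move=> [H1 HM HV] Hx Hy Hu0 Hu1 Hr injx x2 y2 xx yy xy xu0 yu0 xu1 yu1 xr yr.
move=> [E [dot [a [/hilbert_parallelogram para actA properA]]]].
have [a1 aM aA] := actA.
have /choice[u uP] : forall g, exists u : {linear E -> E}, H g ->
    (forall v, `|u v| = `|v|) /\ (forall v, a g v = u v + a g 0).
  move=> g; have [Hg|nHg] := pselect (H g); last by exists idfun.
  have [u [b [un ub]]] := aA g Hg; exists u => _; split => // v.
  by rewrite !ub linear0 add0r.
have un g : H g -> forall v, `|u g v| = `|v| by move=> /uP[].
have ua g v : H g -> a g v = u g v + a g 0 by move=> /uP[_].
have uM g h : H g -> H h -> forall v, u (g * h)%g v = u g (u h v).
  move=> Hg Hh v; apply: (addIr (a (g * h)%g 0)).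
  rewrite -ua; last exact: HM.
  by rewrite !aM // [a h v]ua // (ua g (_ + _)) // linearD -addrA -ua.
have u1E v : u 1%g v = v by have := ua 1%g v H1; rewrite !a1 addr0 => <-.
pose K := `|a u0 0| ^+ 2 + `|a u1 0| ^+ 2 + `|a r 0| ^+ 2 + `|a (y 0%N) 0| ^+ 2.
(* A bound on the orbit of 0 that does not depend on [j] puts the infinitely many [x j] into one of
   the finite sets of [proper_action]. The constant 1200 is generous. *)
suff bound j : `|a (x j) 0| <= 1 + 1200 * K.
  apply: infinite_nat; have := properA (1 + 1200 * K).
  move=> /(finite_preimage (f := x) (fun i k _ _ => @injx i k)).
  apply: sub_finite_set => k _; split; first exact: Hx.
  by exists 0 => //; rewrite normr0; apply: le_trans (normr_ge0 _) (bound k).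
have invol g : H g -> (g * g = 1)%g -> involutive (u g).
  by move=> Hg gg v; rewrite -uM // gg u1E.
have comm g h : H g -> H h -> (g * h = h * g)%g ->
    forall v, u g (u h v) = u h (u g v).
  by move=> Hg Hh gh v; rewrite -!uM // gh.
pose n := j.+1.
(* The index [n] is included because conjugating [x k], [k < n], by [u1] brings in [y k.+1]. *)
have [xi xiP] : exists v, forall k, (k <= n)%N -> a (x k) v = v /\ a (y k) v = v.
  pose s := map x (iota 0 n.+1) ++ map y (iota 0 n.+1).
  have [g|g h|v vP] := @affine_commuting_fixpoint R E G H a s actA.
  - by rewrite mem_cat => /orP[] /mapP[k _ ->].
  - by rewrite !mem_cat => /orP[] /mapP[k _ ->] /orP[] /mapP[l _ ->].
  exists v => k kn; split; apply: vP; rewrite mem_cat.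
    by rewrite map_f ?mem_iota.
  by rewrite orbC map_f ?mem_iota.
(* Since [g] conjugates the [x k], [y k], k < n, into the group fixing [xi],
   both [xi] and [a g xi] are fixed by the [x k], [y k]. *)
have diff_fixed g : H g ->
    (forall k, (k < n)%N -> exists2 h, (x k * g = g * h)%g & H h /\ a h xi = xi) ->
    (forall k, (k < n)%N -> exists2 h, (y k * g = g * h)%g & H h /\ a h xi = xi) ->
    forall k, (k < n)%N -> u (x k) (u g xi + a g 0 - xi) = u g xi + a g 0 - xi
                     /\ u (y k) (u g xi + a g 0 - xi) = u g xi + a g 0 - xi.
  move=> Hg gx gy k kn; rewrite -ua //.
  have fix_diff f h : H f -> H h -> (f * g = g * h)%g -> a h xi = xi ->
      a f xi = xi -> u f (a g xi - xi) = a g xi - xi.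
    move=> Hf Hh fg hxi fxi; rewrite linearB.
    have -> : u f (a g xi) = a g xi - a f 0.
      by apply/eqP; rewrite eq_sym subr_eq -ua // -aM // fg aM // hxi.
    have -> : u f xi = xi - a f 0 by apply/eqP; rewrite eq_sym subr_eq -ua // fxi.
    by rewrite opprB addrA subrK.
  have [xix xiy] := xiP k (ltnW kn).
  have [h1 e1 [Hh1 f1]] := gx k kn; have [h2 e2 [Hh2 f2]] := gy k kn.
  by split; [apply: fix_diff e1 _ _ | apply: fix_diff e2 _ _].
have uxn k := un _ (Hx k); have uyn k := un _ (Hy k).
have uxK k := invol _ (Hx k) (x2 k); have uyK k := invol _ (Hy k) (y2 k).
have uxx i k := comm _ _ (Hx i) (Hx k) (xx i k).
have uxy i k := comm _ _ (Hx i) (Hy k) (xy i k).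
pose X k := u (x k); pose Y k := u (y k).
have parts_fixed g : H g ->
    (forall k, (k < n)%N -> exists2 h, (x k * g = g * h)%g & H h /\ a h xi = xi) ->
    (forall k, (k < n)%N -> exists2 h, (y k * g = g * h)%g & H h /\ a h xi = xi) ->
    forall k, (k < n)%N ->
    [/\ part1 X Y k (u g xi + a g 0) = part1 X Y k xi,
        part2 X Y k (u g xi + a g 0) = part2 X Y k xi
      & part3 X Y k (u g xi + a g 0) = part3 X Y k xi].
  move=> Hg gx gy k kn.
  have [||e1 e2 e3] := @parts_eq0 R E X Y n k (u g xi + a g 0 - xi) kn.
  - by move=> i /(diff_fixed g Hg gx gy)[].
  - by move=> i /(diff_fixed g Hg gx gy)[].
  by split; apply/eqP; rewrite -subr_eq0 -linearB ?e1 ?e2 ?e3.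
have fixM g h : H g -> H h -> a g xi = xi -> a h xi = xi -> a (g * h)%g xi = xi.
  by move=> Hg Hh gxi hxi; rewrite aM // hxi.
have m12 : mass (part1 X Y) n xi <= 5/4 * mass (part2 X Y) n xi + 5 * `|a r 0| ^+ 2.
  apply: (swap_mass para uxn uyn uxy (un _ Hr)) => [k v|k v|k kn].
  - by rewrite -!uM // xr.
  - by rewrite -!uM // yr.
  have [||//] := parts_fixed r Hr _ _ k kn => i /ltnW/xiP[? ?].
  - by exists (y i).
  - by exists (x i).
have m23 : mass (part2 X Y) n xi <= 5/4 * mass (part3 X Y) n xi + 5 * `|a u0 0| ^+ 2.
  apply: (shear0_mass para uxn uyn uyK (un _ Hu0)) => [k v|k v|k kn].
  - by rewrite -[LHS]uM // xu0 !uM //; apply: HM.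
  - by rewrite -!uM // yu0.
  have [||//] := parts_fixed u0 Hu0 _ _ k kn => i /ltnW/xiP[? ?].
  - by exists (x i * y i)%g => //; split; [apply: HM | apply: fixM].
  - by exists (y i).
have m231 : mass (part2 X Y) n xi + mass (part3 X Y) n xi <=
    5/4 * mass (part1 X Y) n xi + 10 * `|a u1 0| ^+ 2
    + `|minus_half (Y 0%N) xi| ^+ 2.
  have inv1 k : (k < n)%N -> [/\ part1 X Y k (u u1 xi + a u1 0) = part1 X Y k xi,
        part2 X Y k (u u1 xi + a u1 0) = part2 X Y k xi
      & part3 X Y k (u u1 xi + a u1 0) = part3 X Y k xi].
    move=> kn; apply: parts_fixed => // i ni.
      have [? _] := xiP i (ltnW ni); have [_ ?] := xiP i.+1 ni.
      by exists (x i * y i.+1)%g => //; split; [apply: HM | apply: fixM].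
    by have [_ ?] := xiP i (ltnW ni); exists (y i).
  apply: (shear1_mass para uxn uyn uyK uxy (un _ Hu1)) => [k v|k v|k|k].
  - by rewrite -[LHS]uM // xu1 !uM //; apply: HM.
  - by rewrite -!uM // yu1.
  - by move=> /inv1[].
  - by move=> /inv1[].
(* If [g] fixes [xi], the displacement of 0 is [xi - u g xi], so the masses of [xi] control it. *)
have disp g : H g -> a g xi = xi -> a g 0 = 2 *: minus_half (u g) xi.
  move=> Hg gxi; rewrite minus_halfE scalerA divff ?scale1r ?pnatr_eq0 //.
  by rewrite -[in LHS](addrK (u g xi) (a g 0)) [a g 0 + _]addrC -ua // gxi.
have [_ y0xi] := xiP 0%N isT; have [xjxi _] := xiP j (leqnSn j).
have norm_disp g : H g -> a g xi = xi ->
    `|a g 0| ^+ 2 = 4 * `|minus_half (u g) xi| ^+ 2.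
  move=> Hg gxi; rewrite disp // normrZ exprMn ger0_norm //; lra.
have := norm_disp _ (Hx j) xjxi; have := norm_disp _ (Hy 0%N) y0xi.
have := displacement_mass para uxn uyn uxK uxx uxy xi (ltnSn j : (j < n)%N).
rewrite -/(X j) -/(Y 0%N).
have := mass_ge0 (part1 X Y) n xi; have := mass_ge0 (part2 X Y) n xi.
have := mass_ge0 (part3 X Y) n xi.
have := sqr_ge0 `|a u0 0|; have := sqr_ge0 `|a u1 0|; have := sqr_ge0 `|a r 0|.
have := sqr_ge0 `|a (y 0%N) 0|; have := sqr_ge0 `|minus_half (Y 0%N) xi|.
have := sqr_ge0 (`|a (x j) 0| - 1).
have := normr_ge0 (a (x j) 0).
rewrite /K.
(* The cycle of three inequalities bounds the mass of [part2] because (5/4)^2 < 1 + 4/5, and then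
   the other two. Finally 2 t <= 1 + t^2 passes from the square of the norm t to t itself. *)
move: (mass _ _ _) (mass _ _ _) (mass _ _ _) m12 m23 m231.
move: (`|a u0 0| ^+ 2) (`|a u1 0| ^+ 2) (`|a r 0| ^+ 2) (`|a (y 0%N) 0| ^+ 2)
  (`|minus_half (Y 0%N) xi| ^+ 2) (`|minus_half (X j) xi| ^+ 2).
move: `|a (x j) 0| => t *; nra.
Qed.

(** * Rays and the parent map of an end *)

Section TreePaths.
Variables (V : choiceType) (e : rel V).
Hypothesis tree : is_tree e.

(** Where the paths diverge, following [p] up to its first vertex [z] on the rest of [q] and
    returning along [q] would give a cycle. It has more than two vertices since the first steps [a]
    and [b] differ. *)
Lemma tree_uniq_path x p q : path e x p -> path e x q -> last x p = last x q ->
  uniq (x :: p) -> uniq (x :: q) -> p = q.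
Proof.
have [_ esym _ _ acyclic] := tree.
elim: p x q => [|a p IH] x [|b q] //.
- by move=> _ _ /= -> _; rewrite mem_last.
- by move=> _ _ /= <-; rewrite mem_last.
move=> exp exq lpq up uq; have [ab|ab] := eqVneq a b.
  move: exp exq up uq lpq; rewrite -{}ab => /andP[_ ep] /andP[_ eq].
  move=> /andP[_ up] /andP[_ uq] lpq.
  by congr cons; apply: (IH a).
have first_hit (A : pred V) s : has A s -> exists z s1 s2,
    [/\ s = rcons s1 z ++ s2, A z & ~~ has A s1].
  by case/split_find => z s1 s2; exists z, s1, s2.
have /first_hit[z [s1 [s2 [def_p zq s1q]]]] : has [in b :: q] (a :: p).
  apply/hasP; exists (last a p); rewrite ?mem_last //; move: lpq => /= ->.
  by rewrite /= mem_last.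
have [q1 [q2 def_q]] : exists q1 q2, b :: q = rcons q1 z ++ q2.
  by case/path.splitP: zq => q1 q2; exists q1, q2.
have /acyclic[] : (2 < size (x :: rcons s1 z ++ rev q1))%N.
  rewrite /= size_cat size_rcons size_rev.
  case: s1 q1 def_p def_q {s1q} => [|? s1] [|? q1] //=; rewrite ?addnS //.
  by move=> [az _] [bz _]; rewrite az bz eqxx in ab.
move: exp exq up uq; rewrite def_p def_q !cat_path => /andP[ep _] /andP[eq _].
rewrite /= !cat_uniq !mem_cat !negb_or.
move=> /andP[/andP[xs1 _] /andP[us1 _]] /andP[/andP[xq1 _] /andP[uq1 _]].
rewrite /ucycle /cycle rcons_cat cat_path ep last_rcons /= mem_cat mem_rev.
rewrite cat_uniq us1 rev_uniq negb_or xs1.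
move: xq1 uq1; rewrite mem_rcons inE negb_or rcons_uniq => /andP[_ ->] /andP[zq1 ->].
rewrite andbT -rev_cons -(belast_rcons x q1 z) -[z in path _ z](last_rcons x q1 z).
rewrite rev_path (eq_path (e' := e)) ?eq //=.
rewrite andbT; apply/hasPn => u; rewrite mem_rev mem_rcons inE => uq1.
apply/norP; split; first by apply: contraNneq zq1 => <-.
apply: contra s1q => us; apply/hasP; exists u => //=.
by rewrite def_q mem_cat mem_rcons inE uq1 orbT.
Qed.

Lemma distance_uniq_path x p : path e x p -> uniq (x :: p) ->
  distance e x (last x p) (size p).
Proof.
move=> ep up; split; first by exists p.
move=> q [eq lq]; case/shortenP: eq lq => q' eq' uq' sub lq'.
rewrite (tree_uniq_path ep eq') //; apply: uniq_leq_size => //.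
by case/andP: uq'.
Qed.

Lemma distance_unique x y m n : distance e x y m -> distance e x y n -> m = n.
Proof.
move=> [[p wp pm] hm] [[q wq qn] hn]; apply/eqP.
by rewrite eqn_leq -{1}qn hm //= -pm hn.
Qed.

Lemma path_segment (r : nat -> V) m l : (forall n, e (r n) (r n.+1)) ->
  path e (r m) [seq r k | k <- iota m.+1 l].
Proof. by move=> er; elim: l m => //= l IH m; rewrite er IH. Qed.

Lemma last_segment (r : nat -> V) m l :
  last (r m) [seq r k | k <- iota m.+1 l] = r (m + l)%N.
Proof. by elim: l m => [|l IH] m /=; rewrite ?addn0 // IH addSnnS. Qed.

(** The first repetition would close a cycle; gaps 1 and 2 are excluded by irreflexivity and by the
    absence of backtracking. *)
Lemma nonbacktracking_inj (r : nat -> V) :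
  (forall n, e (r n) (r n.+1)) -> (forall n, r n != r n.+2) -> injective r.
Proof.
have [_ _ eirr _ acyclic] := tree.
move=> er rn.
suff H n : forall i, (i < n)%N -> r i != r n.
  by move=> i j rij; case: (ltngtP i j) => // /H; rewrite rij eqxx.
elim/ltn_ind: n => n IH i ni; apply/negP => /eqP rin.
have [l def_n] : exists l, n = (i + l.+3)%N.
  have [|gap] := leqP (n - i) 2; last by exists (n - i - 3)%N; lia.
  rewrite leq_eqVlt => /orP[/eqP|] gap.
    have n2 : n = i.+2 by lia.
    by move: (rn i); rewrite -n2 rin eqxx.
  have n1 : n = i.+1 by lia.
  by move: (er i); rewrite -n1 rin eirr.
have /acyclic[] : (2 < size [seq r k | k <- iota i l.+3])%N.
  by rewrite size_map size_iota.
apply/andP; split; last first.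
  rewrite map_inj_in_uniq ?iota_uniq // => j k; rewrite !mem_iota => jn kn rjk.
  case: (ltngtP j k) => // jk.
    by have /negP[] := IH k ltac:(lia) j jk; rewrite rjk.
  by have /negP[] := IH j ltac:(lia) k jk; rewrite rjk.
have := path_segment i l.+3 er.
rewrite -[l.+3]addn1 iotaD map_cat addSnnS addn1 -def_n.
rewrite -[[seq r k | k <- iota n 1]]/[:: r n] cats1 -rin; exact.
Qed.

Lemma nonbacktracking_geodesic (r : nat -> V) :
  (forall n, e (r n) (r n.+1)) -> (forall n, r n != r n.+2) -> geodesic_ray e r.
Proof.
move=> er rn m n mn; have ep := path_segment m (n - m) er.
have := distance_uniq_path ep; rewrite last_segment subnKC // size_map size_iota.
apply; rewrite -[_ :: _]/[seq r k | k <- iota m (n - m).+1].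
by rewrite map_inj_uniq ?iota_uniq //; apply: nonbacktracking_inj.
Qed.

Lemma geodesic_edge (r : nat -> V) n : geodesic_ray e r -> e (r n) (r n.+1).
Proof.
move=> /(_ n n.+1 (leqnSn n)); rewrite subSnn => -[[p [ep lp]] sp _].
by case: p sp ep lp => [|a [|]] //= _ /andP[ea _] <-.
Qed.

Lemma geodesic_inj (r : nat -> V) : geodesic_ray e r -> injective r.
Proof.
move=> gr; suff H m n : (m <= n)%N -> r m = r n -> m = n.
  by move=> m n; case/orP: (leq_total m n) => /H h rmn; [|apply/esym]; apply: h.
move=> mn rmn; have [_ /(_ [::])] := gr m n mn.
by rewrite /walk /= => /(_ (conj isT rmn)); lia.
Qed.

(** The vertex where the rays merge has one distance from the common origin, so the two shifts
    agree; initial segments then coincide by uniqueness of paths. *)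
Lemma geodesic_ray_unique (r s : nat -> V) :
  geodesic_ray e r -> geodesic_ray e s -> ray_equiv r s -> r 0%N = s 0%N ->
  r =1 s.
Proof.
move=> gr gs [m [n rs]] rs0.
have mn : m = n.
  have := gr 0%N m (leq0n _); have := gs 0%N n (leq0n _).
  have := rs 0%N; rewrite !addn0 !subn0 => -> ds dr.
  by apply: distance_unique dr _; rewrite rs0.
move=> [|i] //; have := rs i.+1; rewrite -mn => rsi.
have : [seq r k | k <- iota 1 (m + i.+1)] = [seq s k | k <- iota 1 (m + i.+1)].
  apply: (@tree_uniq_path (r 0%N)).
  - by apply: path_segment => k; exact: geodesic_edge.
  - by rewrite rs0; apply: path_segment => k; exact: geodesic_edge.
  - by rewrite last_segment rs0 last_segment.
  - rewrite -[_ :: _]/[seq r k | k <- iota 0 (m + i.+1).+1].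
    by rewrite map_inj_uniq ?iota_uniq //; apply: geodesic_inj.
  - rewrite rs0 -[_ :: _]/[seq s k | k <- iota 0 (m + i.+1).+1].
    by rewrite map_inj_uniq ?iota_uniq //; apply: geodesic_inj.
by move/eq_in_map; apply; rewrite mem_iota; lia.
Qed.

Lemma ray_equiv_trans (r s t : nat -> V) :
  ray_equiv r s -> ray_equiv s t -> ray_equiv r t.
Proof.
move=> [m [n rs]] [n' [p st]]; exists (m + n')%N, (n + p)%N => k.
rewrite -[(m + n' + k)%N]addnA rs addnCA st; congr t; lia.
Qed.

Lemma ray_equiv_sym (r s : nat -> V) : ray_equiv r s -> ray_equiv s r.
Proof. by move=> [m [n rs]]; exists n, m => k; rewrite rs. Qed.


(** The origin is moved along a path, edge by edge: either the ray starts with this edge and loses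
    its first vertex, or the new origin is prepended without backtracking. *)
Lemma ray_through (w : set (nat -> V)) (x : V) : is_end e w ->
  exists2 r, w r & r 0%N = x.
Proof.
have [_ esym _ conn _] := tree; move=> [r0 gr0 ->].
have step y z : e y z ->
    (exists2 r, geodesic_ray e r /\ ray_equiv r0 r & r 0%N = y) ->
    exists2 r, geodesic_ray e r /\ ray_equiv r0 r & r 0%N = z.
  move=> eyz [r [gr rr] r0y]; have [zr|zr] := eqVneq z (r 1%N).
    exists (fun n => r n.+1) => //; split.
      by move=> m n mn; have := gr m.+1 n.+1 mn; rewrite subSS.
    have [m [n mr]] := rr; exists m.+1, n => k.
    by rewrite -addnS -mr; congr r0; lia.
  pose s n := if n is m.+1 then r m else z.
  exists s => //; split.
    apply: nonbacktracking_geodesic => [[|n]|[|n]] //=.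
    - by rewrite r0y esym.
    - exact: geodesic_edge.
    - by apply/eqP => /(geodesic_inj gr); lia.
  by have [m [n mr]] := rr; exists m, n.+1.
have [p [ep <-]] := conn (r0 0%N) x.
have : exists2 r, geodesic_ray e r /\ ray_equiv r0 r & r 0%N = r0 0%N.
  by exists r0 => //; split=> //; exists 0%N, 0%N.
elim: p (r0 0%N) ep => //= y p IH x0 /andP[exy ep] h.
by apply: IH => //; apply: step h.
Qed.

(* [par x] is the neighbour of [x] in the direction of the end. *)
Lemma end_parent (w : set (nat -> V)) : is_end e w ->
  exists (par : V -> V) (r : nat -> V),
  [/\ forall n, r n.+1 = par (r n),
      forall x y, e x y = (par x == y) || (par y == x),
      forall x y, exists m n, iter m par x = iter n par y,
      forall x m n, iter m par x = iter n par x -> m = n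
    & w = [set s | forall n, s n.+1 = par (s n)]].
Proof.
have [_ esym _ _ _] := tree; move=> wend; have := wend; move=> [r0 gr0 wE].
have /choice[S SP] : forall x, exists s, w s /\ s 0%N = x.
  by move=> x; have [r] := ray_through x wend; exists r.
have wS x : w (S x) by have [] := SP x.
have S0 x : S x 0%N = x by have [] := SP x.
have gS x : geodesic_ray e (S x) by have := wS x; rewrite wE => -[].
have wuniq s t : w s -> w t -> s 0%N = t 0%N -> s =1 t.
  rewrite wE => -[gs rs] [gt rt]; apply: geodesic_ray_unique => //.
  exact: ray_equiv_trans (ray_equiv_sym rs) rt.
have wshift s : w s -> w (fun n => s n.+1).
  rewrite wE => -[gs [m [n rs]]]; split.
    by move=> i j ij; have := gs i.+1 j.+1 ij; rewrite subSS.
  by exists m.+1, n => k; rewrite -addnS -rs; congr r0; lia.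
pose par x := S x 1%N.
have wpar s n : w s -> s n.+1 = par (s n).
  elim: n s => [|n IH] s ws; last exact: IH (wshift _ ws).
  by apply: wuniq => //; rewrite S0.
have Siter x n : S x n = iter n par x.
  by elim: n => [|n IH]; rewrite ?S0 // wpar // IH.
exists par, r0; split.
- by move=> n; apply: wpar; rewrite wE; split => //; exists 0%N, 0%N.
- move=> x y; apply/idP/orP => [exy|[/eqP<-|/eqP<-]]; last 2 first.
  + by have := geodesic_edge 0 (gS x); rewrite S0.
  + by rewrite esym; have := geodesic_edge 0 (gS y); rewrite S0.
  have [|nxy] := eqVneq (par x) y; [by left | right].
  (* Prepending [y] to the ray from [x] gives a ray of the end, hence the ray from [y], so [x] is
     the parent of [y]. *)
  pose s n := if n is m.+1 then S x m else y.
  have ws : w s.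
    rewrite wE; split.
      apply: nonbacktracking_geodesic => [[|n]|[|n]] //=.
      - by rewrite S0 esym.
      - exact: geodesic_edge.
      - by rewrite eq_sym.
      - by apply/eqP => /(geodesic_inj (gS x)); lia.
    have := wS x; rewrite wE => -[_ [m [n mr]]].
    by exists m, n.+1.
  by have := wpar s 0%N ws; rewrite /= S0 => <-.
- move=> x y; have := wS x; have := wS y; rewrite wE => -[_ ry] [_ rx].
  have [m [n xy]] := ray_equiv_trans (ray_equiv_sym rx) ry.
  by exists m, n; rewrite -!Siter; have := xy 0%N; rewrite !addn0.
- by move=> x m n; rewrite -!Siter => /(geodesic_inj (gS x)).
apply/seteqP; split => s /= ws; first by move=> n; apply: wpar.
suff -> : s = S (s 0%N) by [].
by apply/funext; elim=> [|n IH]; rewrite ?S0 // ws wpar // -IH.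
Qed.

(** The children of [x] are its neighbours except the parent; [unbump] closes the gap that the
    number [c] of the parent leaves in the numbering. *)
Lemma children_labelling (L : finType) (l0 : L) (par : V -> V) (x : V) :
  regular_tree e #|L|.+1 ->
  (forall x y, e x y = (par x == y) || (par y == x)) -> par (par x) != x ->
  exists f : V -> L,
    (forall y z, par y = x -> par z = x -> f y = f z -> y = z) /\
    (forall l, exists2 y, par y = x & f y = l).
Proof.
move=> [_ /(_ x)/card_set_bijP phiP] epar ppx.
have [phi [phiA phiI phiS]] :
    exists phi : V -> nat, set_bij [set y | e x y] `I_#|L|.+1 phi by [].
have child y : par y = x <-> e x y /\ y <> par x.
  rewrite epar; split => [pyx|[/orP[/eqP->|/eqP]]] //.
  by rewrite pyx eqxx orbT; split => // yp; rewrite -yp pyx eqxx in ppx.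
have px : [set y | e x y] (par x) by rewrite /= epar eqxx.
pose c := phi (par x); have cL : (c < #|L|.+1)%N := phiA _ px.
have phic y : par y = x -> phi y != c.
  move=> /child[exy yp]; apply/eqP => /phiI h; apply: yp; apply: h; exact: mem_set.
have phil y : par y = x -> (unbump c (phi y) < size (enum L))%N.
  move=> pyx; have := phic y pyx; have /child[/phiA/= + _] := pyx.
  rewrite -cardE /unbump; have := cL.
  by case: (ltngtP c (phi y)) => //=; move: (c : nat) (phi y) #|L| => a b m; lia.
exists (fun y => nth l0 (enum L) (unbump c (phi y))); split => [y z py pz|l].
  move/eqP; rewrite nth_uniq ?enum_uniq ?phil // => /eqP h.
  apply: phiI.
  - by apply: mem_set; case/child: py.
  - by apply: mem_set; case/child: pz.
  by rewrite -(unbumpK (phic _ py)) h unbumpK //; apply: phic.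
have il : (index l (enum L) < #|L|)%N by rewrite cardE index_mem mem_enum.
have [|y exy phiy] := phiS (bump c (index l (enum L))).
  by rewrite /= ltnS /bump; case: (c <= _)%N => //; exact: ltnW il.
exists y.
  apply/child; split=> // yp.
  by have := neq_bump c (index l (enum L)); rewrite -phiy yp eqxx.
by rewrite phiy bumpK nth_index // mem_enum.
Qed.

End TreePaths.

(** * Horocyclic coordinates *)

Section Causal.
Variable L : zmodType.
Implicit Types (a c : int -> L).

Definition vanishes_up c := exists M : nat, forall j, M%:Z <= j -> c j = 0.

(* Vertices of height [h] will be the sequences on [h, +oo[ with finite support;
   these are the operators that descend to all of them while shifting heights
   by [k]. *)
Definition causal (k : int) (P : (int -> L) -> int -> L) :=
  (forall c, vanishes_up c -> vanishes_up (P c)) /\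
  (forall c d h, (forall j, h <= j -> c j = d j) ->
     forall j, h + k <= j -> P c j = P d j).

Lemma translate_causal a : vanishes_up a -> causal 0 (fun c j => c j + a j).
Proof.
move=> [M aM]; split=> [c [N cN]|c d h cd j hj].
  by exists (maxn M N) => j hj; rewrite aM ?cN ?addr0 //; lia.
by rewrite cd //; lia.
Qed.

Lemma shift_causal k : causal k (fun c j => c (j - k)).
Proof.
split=> [c [N cN]|c d h cd j hj]; last by rewrite cd //; lia.
by exists (N + `|k|)%N => j hj; rewrite cN //; lia.
Qed.

Lemma shear_causal (N : L -> L) (d : nat) : N 0 = 0 ->
  causal 0 (fun c j => c j + N (c (j + d%:Z))).
Proof.
move=> N0; split=> [c [M cM]|c c' h cc j hj].
  by exists M => j hj; rewrite !cM ?N0 ?addr0 //; lia.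
by rewrite !cc //; lia.
Qed.

Lemma pointwise_causal (f : L -> L) : f 0 = 0 -> causal 0 (fun c j => f (c j)).
Proof.
move=> f0; split=> [c [M cM]|c d h cd j hj]; last by rewrite cd //; lia.
by exists M => j hj; rewrite cM.
Qed.

End Causal.

Section Coordinates.
Variables (V : choiceType) (L : zmodType) (par : V -> V).
Variables (lab : V -> L) (ht : V -> int).
Hypotheses (par_meet : forall x y, exists m n, iter m par x = iter n par y)
  (lab_inj : forall x y, par x = par y -> lab x = lab y -> x = y)
  (ht_par : forall x, ht (par x) = ht x + 1).

Implicit Types (P Q : (int -> L) -> int -> L).

Lemma ht_iter n x : ht (iter n par x) = ht x + n%:Z.
Proof. by elim: n => [|n IH]; rewrite ?addr0 //= ht_par IH; lia. Qed.

(** Heights grow towards the end. The value 0 below [ht x] is a filler, on which the conditions in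
    [realises] do not depend when the operator is causal. *)
Definition coordinate (x : V) (j : int) : L :=
  if ht x <= j then lab (iter `|j - ht x|%N par x) else 0.

Lemma coord_ht x : coordinate x (ht x) = lab x.
Proof. by rewrite /coordinate lexx subrr. Qed.

Lemma coord_par x j : ht x + 1 <= j -> coordinate (par x) j = coordinate x j.
Proof.
move=> xj; rewrite /coordinate ht_par xj ifT; last by lia.
have -> : `|j - ht x|%N = `|j - (ht x + 1)%R|%N.+1 by lia.
by rewrite iterSr.
Qed.

(** Vertices of equal height meet after equally many steps; going down from the common ancestor,
    labels separate siblings. *)
Lemma coord_inj x y : ht x = ht y ->
  (forall j, ht x <= j -> coordinate x j = coordinate y j) -> x = y.
Proof.
have [m [n xy]] := par_meet x y; move=> hxy.
have mn : m = n by have := congr1 ht xy; rewrite !ht_iter hxy; lia.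
rewrite -{n}mn in xy; elim: m x y xy hxy => [|m IH] x y //.
rewrite !iterSr => xy hxy cxy; apply: lab_inj.
  apply: IH => //; first by rewrite !ht_par hxy.
  by move=> j; rewrite ht_par => hj; rewrite !coord_par -?hxy ?cxy //; lia.
by rewrite -!coord_ht -hxy cxy.
Qed.

Definition realises (k : int) P (g : V -> V) := forall x,
  ht (g x) = ht x + k /\
  forall j, ht x + k <= j -> coordinate (g x) j = P (coordinate x) j.

Lemma realises_comp k l P Q f g : causal k P -> realises k P f -> realises l Q g ->
  realises (k + l) (P \o Q) (f \o g).
Proof.
move=> [_ Pc] fP gQ x; have [hg cg] := gQ x; have [hf cf] := fP (g x).
rewrite /= hf hg; split=> [|j hj]; first by lia.
rewrite cf ?hg //; last by lia.
by apply: Pc cg _ _; lia.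
Qed.

(** This reduces relations between automorphisms to pointwise identities between operators on
    sequences. *)
Lemma realises_eq k P Q f g : realises k P f -> realises k Q g ->
  (forall c j, P c j = Q c j) -> f =1 g.
Proof.
move=> fP gQ PQ x; have [hf cf] := fP x; have [hg cg] := gQ x.
by apply: coord_inj; rewrite ?hf ?hg // => j hj; rewrite cf ?cg // PQ.
Qed.

Lemma realises_id : realises 0 id id.
Proof. by move=> x; rewrite addr0. Qed.

(** Passing to the parent drops the lowest coordinate, and by causality the higher coordinates of
    the image do not depend on it. *)
Lemma realises_par k P g : causal k P -> realises k P g ->
  forall x, g (par x) = par (g x).
Proof.
move=> [_ Pc] gP x; have [hg cg] := gP x; have [hp cp] := gP (par x).
apply: coord_inj => [|j]; rewrite hp !ht_par ?hg; first by lia.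
move=> hj; rewrite cp ?ht_par // coord_par ?hg ?cg; try lia.
by apply: (Pc _ _ (ht x + 1)) => // i hi; rewrite coord_par.
Qed.

Variable r : nat -> V.
Hypotheses (par_r : forall n, r n.+1 = par (r n))
  (lab_surj : forall x l, exists2 y, par y = x & lab y = l)
  (lab_r : forall n, lab (r n) = 0) (ht_r0 : ht (r 0%N) = 0).

Lemma iter_r m n : iter m par (r n) = r (m + n)%N.
Proof. by elim: m => //= m ->; rewrite par_r. Qed.

Lemma ht_r n : ht (r n) = n%:Z.
Proof. by rewrite -[n]addn0 -iter_r ht_iter ht_r0 addn0 add0r. Qed.

Lemma iter_par_r x : exists m n, iter m par x = r n.
Proof.
have [m [n xr]] := par_meet x (r 0%N).
by exists m, n; rewrite xr iter_r addn0.
Qed.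

Lemma coord_vanishes x : vanishes_up (coordinate x).
Proof.
have [m [n xr]] := iter_par_r x; exists n => j nj.
have hx : ht x = n%:Z - m%:Z by have := congr1 ht xr; rewrite ht_iter ht_r; lia.
rewrite /coordinate; case: ifP => // xj.
have -> : `|j - ht x|%N = (`|j - n%:Z| + m)%N by lia.
by rewrite iterD xr iter_r lab_r.
Qed.

(** Start on the ray [r] above the support of [c], where all coordinates vanish, and descend through
    children with the prescribed labels. *)
Lemma vertex_ex c h : vanishes_up c ->
  exists x, ht x = h /\ forall j, h <= j -> coordinate x j = c j.
Proof.
move=> [M cM].
have [N [MN hN]] : exists N : nat, (M <= N)%N /\ h <= N%:Z.
  by exists (M + `|h|)%N; lia.
suff H i : exists x, ht x = N%:Z - i%:Z /\
    forall j, N%:Z - i%:Z <= j -> coordinate x j = c j.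
  have [x] := H `|N%:Z - h|%N; have -> : N%:Z - `|N%:Z - h|%N%:Z = h by lia.
  by exists x.
elim: i => [|i [x [hx cx]]].
  exists (r N); rewrite ht_r subr0; split=> // j Nj.
  by rewrite cM ?/coordinate ?ht_r ?Nj ?iter_r ?lab_r //; lia.
have [y yx ly] := lab_surj x (c (N%:Z - i.+1%:Z)).
have hy : ht y = N%:Z - i.+1%:Z by have := ht_par y; rewrite yx hx; lia.
exists y; split=> // j; rewrite le_eqVlt => /predU1P[<-|ij].
  by rewrite -hy coord_ht ly -hy.
by rewrite -coord_par ?hy ?yx ?cx //; lia.
Qed.

Lemma realises_ex k P : causal k P -> exists g, realises k P g.
Proof.
move=> [Pv _]; have /choice[g gP] : forall x, exists y,
    ht y = ht x + k /\
    forall j, ht x + k <= j -> coordinate y j = P (coordinate x) j.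
  by move=> x; apply: vertex_ex; apply: Pv; apply: coord_vanishes.
by exists g.
Qed.

Lemma realises_aut (e : rel V) k P Q :
  (forall x y, e x y = (par x == y) || (par y == x)) ->
  causal k P -> causal (- k) Q ->
  (forall c j, P (Q c) j = c j) -> (forall c j, Q (P c) j = c j) ->
  exists g : aut e, realises k P g.
Proof.
move=> epar cP cQ PQ QP; have [f fP] := realises_ex cP.
have [g gQ] := realises_ex cQ.
have fK : cancel f g.
  apply: (realises_eq (k := 0) (P := Q \o P) (Q := id)) => //.
    by have := realises_comp cQ gQ fP; rewrite addNr.
  exact: realises_id.
have gK : cancel g f.
  apply: (realises_eq (k := 0) (P := P \o Q) (Q := id)) => //.
    by have := realises_comp cP fP gQ; rewrite addrN.
  exact: realises_id.
have fm : {mono f : x y / e x y}.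
  move=> x y; rewrite !epar -!(realises_par cP fP).
  by rewrite !(can_eq fK).
by exists (Aut (Bijective fK gK) fm).
Qed.

(** Every vertex has an ancestor on [r], and each vertex has countably many descendants in each
    generation. *)
Lemma vertices_countable : countable [set: L] -> countable [set: V].
Proof.
move=> /countable_injP[phi phi_inj].
have fib m y : countable [set x | iter m par x = y].
  elim: m y => [|m IH] y; first exact: countable1.
  rewrite (_ : [set x | _] =
      \bigcup_(z in [set z | iter m par z = y]) [set x | par x = z]).
    apply: bigcup_countable => // z _; apply/countable_injP.
    exists (phi \o lab) => x x' /set_mem/= xz /set_mem/= xz' /phi_inj h.
    by apply: lab_inj; [rewrite xz xz' | apply: h; exact: mem_set].
  apply/seteqP; split=> x /=; first by rewrite -iterS iterSr => h; exists (par x).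
  by case=> z /= h xz; rewrite -iterS iterSr xz.
rewrite (_ : [set: V] = \bigcup_(m in [set: nat]) \bigcup_(n in [set: nat])
    [set x | iter m par x = r n]).
  by do 2![apply: bigcup_countable => // ? _].
apply/seteqP; split=> // x _; have [m [n h]] := iter_par_r x.
by exists m => //; exists n.
Qed.

End Coordinates.

(** * Closures of groups of automorphisms *)

Section Closure.
Variables (V : choiceType) (e : rel V).
Implicit Types (g h : aut e) (H : set (aut e)).

Lemma nbhs_aut g (s : seq V) : nbhs g [set h : aut e | {in s, h =1 g}].
Proof.
elim: s => [|x s IH]; first by apply: filterS filterT => h _ y.
have gx : nbhs g [set h : aut e | h x = g x].
  apply: open_nbhs_nbhs; split=> //.
  exists (proj x @^-1` [set g x : discrete_topology V]) => //.
  apply: open_comp => [f _|]; first exact: proj_continuous.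
  exact: discrete_open.
apply: filterS (filterI gx IH) => h [/= hx hs] y; rewrite inE => /predU1P[->//|].
exact: hs.
Qed.

(** The filter [F] generated by agreement with [g] on finite lists converges to [g] in every
    coordinate, hence in the product topology. *)
Lemma aut_nbhs g (B : set (aut e)) : nbhs g B ->
  exists s : seq V, [set h : aut e | {in s, h =1 g}] `<=` B.
Proof.
pose F : set_system {ptws V -> discrete_topology V} :=
  [set A | exists s : seq V, [set f : V -> V | {in s, f =1 g}] `<=` A].
have FF : Filter F.
  split; first by exists [::].
  - move=> A1 A2 [s1 sA1] [s2 sA2]; exists (s1 ++ s2) => f fg.
    by split; [apply: sA1 | apply: sA2] => x xs; apply: fg; rewrite mem_cat xs ?orbT.
  - by move=> A1 A2 A12 [s sA1]; exists s => f /sA1 /A12.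
have Fg : F --> (g : {ptws V -> discrete_topology V}).
  apply/cvg_sup => x U [W] [[C] oC <-] Wg WU; apply: (filterS WU).
  by exists [:: x] => f /(_ x (mem_head _ _)) /= fx; rewrite /= fx.
rewrite nbhsE => -[U [[A oA AU] Ug] UB].
have /Fg[s sA] : nbhs (g : {ptws V -> discrete_topology V}) A.
  by apply: open_nbhs_nbhs; split=> //; rewrite -AU in Ug.
by exists s => h hg; apply: UB; rewrite -AU; apply: sA.
Qed.

Lemma closure_autP H g :
  closure H g <-> forall s : seq V, exists2 h, H h & {in s, h =1 g}.
Proof.
split=> [cHg s|Hs B /aut_nbhs[s sB]].
  by have [h [Hh hg]] := cHg _ (nbhs_aut g s); exists h.
by have [h Hh hg] := Hs s; exists h; split=> //; apply: sB.
Qed.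

Lemma closure_subgroup H : is_subgroup H -> is_subgroup (closure H).
Proof.
move=> [H1 HM HV]; split; first exact: subset_closure.
- move=> g h /closure_autP cg /closure_autP ch; apply/closure_autP => s.
  have [h' Hh' hh'] := ch s; have [g' Hg' gg'] := cg [seq h x | x <- s].
  exists (g' * h')%g; first exact: HM.
  by move=> x xs /=; rewrite hh' // gg' // map_f.
- move=> g /closure_autP cg; apply/closure_autP => s.
  have [gK gVK] := aut_invK g.
  (* If [g'] agrees with [g] on the preimages of [s] under [g], the inverses agree on [s]. *)
  have [g' Hg' gg'] := cg [seq (g^-1)%g x | x <- s].
  have [g'K g'VK] := aut_invK g'.
  exists (g'^-1)%g; first exact: HV.
  move=> x xs; rewrite -{1}[x]gVK -gg' ?g'K //; exact: map_f.
Qed.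

Definition par_stabilizer (par : V -> V) : set (aut e) :=
  [set g | forall x, g (par x) = par (g x)].

Lemma par_stabilizer_subgroup par : is_subgroup (par_stabilizer par).
Proof.
split=> // [g h gp hp x|g gp x] /=; first by rewrite hp gp.
have [gK gVK] := aut_invK g.
by rewrite -{1}[x]gVK -gp gK.
Qed.

Lemma closure_par_stabilizer par H :
  H `<=` par_stabilizer par -> closure H `<=` par_stabilizer par.
Proof.
move=> Hp g /closure_autP/= cg x; have [h Hh hg] := cg [:: x; par x].
by rewrite -!hg ?inE ?eqxx ?orbT //; apply: Hp.
Qed.

Lemma par_stabilizer_end par :
  par_stabilizer par `<=` @aut_end V e [set s | forall n, s n.+1 = par (s n)].
Proof.
move=> g gp; have [gK gVK] := aut_invK g.
have gVp := (par_stabilizer_subgroup par).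
apply/seteqP; split=> [_ [s sp <-] n /=|s sp /=]; first by rewrite sp gp.
exists ((g^-1)%g \o s); last by apply/funext => n /=; rewrite gVK.
move=> n /=; have [_ _ /(_ _ gp) h] := gVp.
by rewrite sp h.
Qed.

Lemma scale_group_closure par H : is_subgroup H -> vertex_transitive H ->
  H `<=` par_stabilizer par ->
  is_end e [set s | forall n, s n.+1 = par (s n)] -> scale_group (closure H).
Proof.
move=> sH tH Hp wend; split.
- exact: closure_subgroup.
- exact: closed_closure.
- by move=> x y; have [g Hg gxy] := tH x y; exists g => //; apply: subset_closure.
exists [set s | forall n, s n.+1 = par (s n)] => //.
exact: subset_trans (closure_par_stabilizer Hp) (@par_stabilizer_end par).
Qed.

End Closure.

(** [H] is the subgroup generated by [D], countable as the image of the words in signed indices.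
    Countability gives content to the failure of the Haagerup property, which is automatic for
    uncountable groups. *)
Lemma countable_subgroup (G : groupType) (D K : set G) :
  countable D -> is_subgroup K -> D `<=` K ->
  exists H : set G, [/\ is_subgroup H, countable H, D `<=` H & H `<=` K].
Proof.
move=> /countable_injP[phi phi_inj] sK DK.
pose H := [set g | forall K', is_subgroup K' -> D `<=` K' -> K' g].
exists H; split; last by move=> g; apply.
- split=> [K' [] //|g h Hg Hh K' sK' DK'|g Hg K' sK' DK'].
    by case: (sK') => _ M _; apply: M; [apply: Hg | apply: Hh].
  by case: (sK') => _ _ M; apply: M; apply: Hg.
- have /choice[f fP] : forall n, exists g, forall d, D d -> phi d = n -> g = d.
    move=> n; have [[d [Dd dn]]|nD] := pselect (exists d, D d /\ phi d = n).
      exists d => d' Dd' d'n; apply: phi_inj; rewrite ?dn //; exact: mem_set.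
    by exists 1%g => d Dd dn; case: nD; exists d.
  pose val (p : nat * bool) := if p.2 then f p.1 else ((f p.1)^-1)%g.
  pose prod (s : seq (nat * bool)) := foldr (fun p g => val p * g)%g 1%g s.
  have prodD s t : prod (s ++ t) = (prod s * prod t)%g.
    by elim: s => [|p s IH] /=; rewrite ?mul1g // IH mulgA.
  apply: (sub_countable _ (countableP [set: seq (nat * bool)])).
  apply: card_le_trans (card_image_le prod _); apply: subset_card_le.
  move=> g; apply; last first.
    by move=> d Dd; exists [:: (phi d, true)] => //=; rewrite mulg1 /val /= (fP _ d).
  split; first by exists [::].
    by move=> _ _ [s _ <-] [t _ <-]; exists (s ++ t).
  move=> _ [s _ <-]; exists (rev [seq (p.1, ~~ p.2) | p <- s]) => //.
  elim: s => [|p s IH] /=; first by rewrite invg1.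
  rewrite rev_cons -cats1 prodD IH invgM /= mulg1; congr (_ * _)%g.
  by rewrite /val /=; case: p.2; rewrite /= ?invgK.
- by move=> d Dd K' _; apply.
Qed.

(** * The shear group in the automorphism group of the tree *)

Lemma horocyclic_labelling (V : choiceType) (L : zmodType) (par : V -> V)
    (r : nat -> V) :
  (forall n, r n.+1 = par (r n)) ->
  (forall x y, exists m n, iter m par x = iter n par y) ->
  (forall x m n, iter m par x = iter n par x -> m = n) ->
  (forall x, exists f : V -> L,
    (forall y z, par y = x -> par z = x -> f y = f z -> y = z) /\
    (forall l, exists2 y, par y = x & f y = l)) ->
  exists (lab : V -> L) (ht : V -> int),
  [/\ forall x y, par x = par y -> lab x = lab y -> x = y,
      forall x l, exists2 y, par y = x & lab y = l,
      forall n, lab (r n) = 0,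
      forall x, ht (par x) = ht x + 1
    & ht (r 0%N) = 0].
Proof.
move=> par_r meet par_inj /choice[F FP].
have rE n : r n = iter n par (r 0%N) by elim: n => //= n <-.
have r_inj : injective r by move=> i k; rewrite (rE i) (rE k) => /par_inj.
(* [sc x] is the child of [x] on the ray; where there is none, its value is an arbitrary default.
   Subtracting the label of this child makes the labels vanish along [r]. *)
have /choice[sc scP] : forall x, exists z, forall n, x = r n.+1 -> z = r n.
  move=> x; have [[n xn]|nx] := pselect (exists n, x = r n.+1).
    by exists (r n) => m; rewrite xn => /r_inj[->].
  by exists x => n xn; case: nx; exists n.
have /choice[ht htP] : forall x, exists h : int,
    exists m n, iter m par x = r n /\ h = n%:Z - m%:Z.
  move=> x; have [m [n xr]] := meet x (r 0%N).
  by exists (n%:Z - m%:Z), m, n; rewrite xr rE.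
have htE x m n : iter m par x = r n -> ht x = n%:Z - m%:Z.
  have [m' [n' [xr ->]]] := htP x => xr'.
  have : iter (m' + n) par (r 0%N) = iter (m + n') par (r 0%N).
    by rewrite !iterD -!rE -xr -xr' -!iterD addnC.
  by move/par_inj; lia.
exists (fun y => F (par y) y - F (par y) (sc (par y))), ht; split.
- move=> x y xy; rewrite xy => /addIr; have [Finj _] := FP (par y).
  by apply: Finj.
- move=> x l; have [_ /(_ (l + F x (sc x)))[y yx yl]] := FP x.
  by exists y => //; rewrite yx yl addrK.
- by move=> n; rewrite -par_r (scP _ n) // subrr.
- move=> x; have [m [n [xr hx]]] := htP x.
  by rewrite hx (htE (par x) m n.+1) ?par_r -?xr -?iterSr //; lia.
- by rewrite (htE _ 0%N 0%N).
Qed.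

Lemma countable_setU (T : Type) (A B : set T) :
  countable A -> countable B -> countable (A `|` B).
Proof.
move=> cA cB; rewrite -bigcup2E; apply: bigcup_countable => // -[|[|n]] _ //=.
Qed.

Lemma range_countable (T U : Type) (f : T -> U) :
  countable [set: T] -> countable (range f).
Proof. by apply: sub_countable; apply: card_image_le. Qed.

Section ShearGroup.
Variables (V : choiceType) (e : rel V) (m : nat).
Local Notation L := (bool * bool * 'I_m.+1)%type.
Variables (par : V -> V) (r : nat -> V) (lab : V -> L) (ht : V -> int).
Hypotheses (par_r : forall n, r n.+1 = par (r n))
  (epar : forall x y, e x y = (par x == y) || (par y == x))
  (par_meet : forall x y, exists m n, iter m par x = iter n par y)
  (lab_inj : forall x y, par x = par y -> lab x = lab y -> x = y)
  (lab_surj : forall x l, exists2 y, par y = x & lab y = l)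
  (lab_r : forall n, lab (r n) = 0)
  (ht_par : forall x, ht (par x) = ht x + 1) (ht_r0 : ht (r 0%N) = 0).

Local Notation realises := (realises par lab ht).
Local Notation coordinate := (coordinate par lab ht).

Let realised k P (g : aut e) := causal k P /\ realises k P g.

Let realised_mul P Q f g :
  realised 0 P f -> realised 0 Q g -> realised 0 (P \o Q) (f * g)%g.
Proof.
move=> [cP fP] [cQ gQ]; split; last by have := realises_comp cP fP gQ; rewrite addr0.
have [Pv Pc] := cP; have [Qv Qc] := cQ.
split=> [c /Qv/Pv //|c d h /Qc cd].
by apply: Pc => j hj; apply: cd; rewrite addr0.
Qed.

Let realised_eq P Q f g : realised 0 P f -> realised 0 Q g ->
  (forall c j, P c j = Q c j) -> f = g.
Proof.
move=> [_ fP] [_ gQ] PQ; apply: aut_eqP.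
exact: (realises_eq par_meet lab_inj ht_par fP gQ PQ).
Qed.

Let realised_ex k P Q : causal k P -> causal (- k) Q ->
  (forall c j, P (Q c) j = c j) -> (forall c j, Q (P c) j = c j) ->
  exists g, realised k P g.
Proof.
move=> cP cQ PQ QP.
have [g gP] := realises_aut par_meet lab_inj ht_par par_r lab_surj lab_r ht_r0
  epar cP cQ PQ QP.
by exists g.
Qed.

Let realised_one : realised 0 id 1%g.
Proof.
split; last exact: realises_id.
by split=> // c d h cd j; rewrite addr0; apply: cd.
Qed.

Let lower (l : L) : L := (false, l.1.1, 0).
Let flip (l : L) : L := (l.1.2, l.1.1, l.2).
(** The monomial t^k sits at height -k: causal operators read at or above the height where they
    write, so multiplication by t has to move downwards. *)
Let delta (k : nat) (l : L) (j : int) : L := if j == - k%:Z then l else 0.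
Let translate (a c : int -> L) (j : int) : L := c j + a j.
Let shear (d : nat) (c : int -> L) (j : int) : L := c j + lower (c (j + d%:Z)).
Let swap (c : int -> L) (j : int) : L := flip (c j).
Let ex : L := (true, false, 0).
Let ey : L := (false, true, 0).

Let lowerD : {morph lower : k l / k + l}.
Proof. by move=> [[a b] i] [[a' b'] i']; congr (_, _, _); exact/esym/addr0. Qed.

Let flipD : {morph flip : k l / k + l}.
Proof. by move=> [[a b] i] [[a' b'] i']. Qed.

Let lower_lower l : lower (lower l) = 0. Proof. by []. Qed.

Let lower_char2 l : lower l + lower l = 0.
Proof.
by case: l => [[[] b] i]; rewrite /lower /=; congr (_, _, _); apply: addr0.
Qed.

Let delta_char2 k l j : l + l = 0 -> delta k l j + delta k l j = 0.
Proof. by rewrite /delta => ll; case: ifP => // _; rewrite addr0. Qed.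

Let ex2 : ex + ex = 0. Proof. by congr (_, _, _); apply: addr0. Qed.
Let ey2 : ey + ey = 0. Proof. by congr (_, _, _); apply: addr0. Qed.

Let lower_delta_ex k d j : lower (delta k ex (j + d%:Z)) = delta (k + d) ey j.
Proof.
rewrite /delta; have -> : (j + d%:Z == - k%:Z) = (j == - (k + d)%N%:Z) by lia.
by case: ifP.
Qed.

Let lower_delta_ey k j : lower (delta k ey j) = 0.
Proof. by rewrite /delta; case: ifP. Qed.

Let delta_vanishes k l : vanishes_up (delta k l).
Proof. by exists 1%N => j j1; rewrite /delta ifF //; lia. Qed.

Let opp_vanishes a : vanishes_up a -> vanishes_up (fun j => - a j : L).
Proof. by move=> [M aM]; exists M => j /aM ->; rewrite oppr0. Qed.

(** This is the relation x_k u_d = u_d x_k y_(k+d): the shear of the x-translation produces a second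
    copy of the y-translation, and the two cancel in characteristic 2. *)
Let shear_translate k d c j :
  translate (delta k ex) (shear d c) j =
  shear d (translate (delta k ex) (translate (delta (k + d) ey) c)) j.
Proof.
rewrite /shear /translate !lowerD lower_delta_ex lower_delta_ey addr0.
by rewrite [in RHS](addrAC (c j)) addrACA (delta_char2 _ _ ey2) addr0 addrAC.
Qed.

Let shear_translate_ey k d c j : translate (delta k ey) (shear d c) j =
  shear d (translate (delta k ey) c) j.
Proof. by rewrite /shear /translate lowerD lower_delta_ey addr0 addrAC. Qed.

Lemma shear_group_exists : exists H : set (aut e),
  [/\ is_subgroup H, countable H, H `<=` par_stabilizer par,
      vertex_transitive H & forall R : realType, ~ haagerup R H].
Proof.
have translate_ex a : vanishes_up a -> exists g, realised 0 (translate a) g.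
  move=> av; apply: (@realised_ex 0 _ (translate (fun j => - a j))).
  - exact: translate_causal.
  - by rewrite oppr0; apply: translate_causal; apply: opp_vanishes.
  - by move=> c j; rewrite /translate subrK.
  - by move=> c j; rewrite /translate addrK.
have /choice[x xP] : forall k, exists g, realised 0 (translate (delta k ex)) g.
  by move=> k; exact: translate_ex (delta_vanishes k ex).
have /choice[y yP] : forall k, exists g, realised 0 (translate (delta k ey)) g.
  by move=> k; exact: translate_ex (delta_vanishes k ey).
have /choice[t tP] : forall v, exists g, realised 0 (translate (coordinate v)) g.
  move=> v; apply: translate_ex.
  exact (coord_vanishes par_meet ht_par par_r lab_r ht_r0 v).
have /choice[s sP] : forall k, exists g, realised k (fun c j => c (j - k)) g.
  move=> k; apply: (@realised_ex k _ (fun c j => c (j - - k))).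
  - exact: shift_causal.
  - exact: shift_causal.
  - by move=> c j; rewrite opprK subrK.
  - by move=> c j; rewrite opprK addrK.
have /choice[u uP] : forall d, exists g, realised 0 (shear d) g.
  move=> d; have ss c j : shear d (shear d c) j = c j.
    by rewrite /shear lowerD lower_lower addr0 -addrA lower_char2 addr0.
  apply: (@realised_ex 0 _ (shear d)) => //; last rewrite oppr0;
    exact: shear_causal.
have [w wP] : exists g, realised 0 swap g.
  have ww c j : swap (swap c) j = c j by rewrite /swap; case: (c j) => [[]].
  apply: (@realised_ex 0 _ swap) => //; last rewrite oppr0;
    exact: pointwise_causal.
(* The families [t] and [s] provide transitivity; [x], [y], [u] and [w] provide the relations of the
   shear group. *)
pose D := range x `|` range y `|` range t `|` range s `|` (range u `|` [set w]).
have Dpar : D `<=` par_stabilizer par.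
  suff parP k P g : realised k P g -> par_stabilizer par g.
    move=> g [[[[[k _ <-]|[k _ <-]]|[v _ <-]]|[k _ <-]]|[[d _ <-]|->]].
    - exact: parP (xP k).
    - exact: parP (yP k).
    - exact: parP (tP v).
    - exact: parP (sP k).
    - exact: parP (uP d).
    - exact: parP wP.
  move=> [cP gP]; exact: (realises_par par_meet lab_inj ht_par cP gP).
have Vc : countable [set: V].
  exact (vertices_countable par_meet lab_inj par_r (countableP [set: L])).
have Dc : countable D.
  by do !apply: countable_setU; rewrite ?countable1 //; apply: range_countable.
have [H [sH cH DH Hpar]] :=
  countable_subgroup Dc (par_stabilizer_subgroup e par) Dpar.
have Hx k : H (x k) by apply: DH; do 4!left; exists k.
have Hy k : H (y k) by apply: DH; do 3!left; right; exists k.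
have Ht v : H (t v) by apply: DH; do 2!left; right; exists v.
have Hs k : H (s k) by apply: DH; left; right; exists k.
have Hu d : H (u d) by apply: DH; right; left; exists d.
have Hw : H w by apply: DH; right; right.
have [H1 HM HV] := sH.
have s_r k : ht (s k (r 0%N)) = k /\
    forall j, k <= j -> coordinate (s k (r 0%N)) j = 0.
  have [_ /(_ (r 0%N))] := sP k; rewrite ht_r0 add0r => -[hs cs]; split=> // j kj.
  rewrite cs // /coordinate ht_r0; case: ifP => // _.
  by rewrite (iter_r par_r) lab_r.
(* Shift [r 0] to the height of [v], where its coordinates are still 0, then translate by the
   coordinates of [v]. *)
have orbit v : exists2 g, H g & g (r 0%N) = v.
  exists (t v * s (ht v))%g; first exact: HM.
  have [hs cs] := s_r (ht v); have [_ /(_ (s (ht v) (r 0%N)))[htv ctv]] := tP v.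
  apply: (coord_inj par_meet lab_inj ht_par) => /= [|j]; rewrite htv hs addr0 //.
  by move=> hj; rewrite ctv ?hs ?addr0 // /translate cs // add0r.
exists H; split=> //.
  move=> v v'; have [g Hg <-] := orbit v; have [g' Hg' <-] := orbit v'.
  exists (g' * g^-1)%g; first by apply: HM => //; apply: HV.
  by have [gK _] := aut_invK g; rewrite /= gK.
move=> R; apply: (@shear_group_not_haagerup R _ H x y (u 0%N) (u 1%N) w) => //.
(* On a vertex of height -k with zero coordinates, [x k] changes the coordinate at -k, and [x k']
   with another index does not. *)
- move=> k k' xkk'; apply/eqP; apply: contraT => kk'.
  have [hs cs] := s_r (- k%:Z); pose v := s (- k%:Z) (r 0%N).
  have [_ /(_ v)[_ /(_ (- k%:Z))]] := xP k.
  have [_ /(_ v)[_ /(_ (- k%:Z))]] := xP k'.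
  rewrite xkk' hs addr0 => /(_ (lexx _)) -> /(_ (lexx _)).
  rewrite /translate => /addrI; rewrite /delta eqxx ifF //.
  by apply/negbTE; rewrite eqr_opp eqz_nat.
- move=> k; apply: realised_eq (realised_mul (xP k) (xP k)) realised_one _ => c j /=.
  by rewrite /translate -addrA (delta_char2 _ _ ex2) addr0.
- move=> k; apply: realised_eq (realised_mul (yP k) (yP k)) realised_one _ => c j /=.
  by rewrite /translate -addrA (delta_char2 _ _ ey2) addr0.
- move=> i k; apply: realised_eq (realised_mul (xP i) (xP k))
    (realised_mul (xP k) (xP i)) _ => c j /=.
  exact: addrAC.
- move=> i k; apply: realised_eq (realised_mul (yP i) (yP k))
    (realised_mul (yP k) (yP i)) _ => c j /=.
  exact: addrAC.
- move=> i k; apply: realised_eq (realised_mul (xP i) (yP k))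
    (realised_mul (yP k) (xP i)) _ => c j /=.
  exact: addrAC.
- move=> k; apply: realised_eq (realised_mul (xP k) (uP 0%N))
    (realised_mul (uP 0%N) (realised_mul (xP k) (yP k))) _ => c j /=.
  by rewrite shear_translate addn0.
- move=> k; apply: realised_eq (realised_mul (yP k) (uP 0%N))
    (realised_mul (uP 0%N) (yP k)) _ => c j /=.
  exact: shear_translate_ey.
- move=> k; apply: realised_eq (realised_mul (xP k) (uP 1%N))
    (realised_mul (uP 1%N) (realised_mul (xP k) (yP k.+1))) _ => c j /=.
  by rewrite shear_translate addn1.
- move=> k; apply: realised_eq (realised_mul (yP k) (uP 1%N))
    (realised_mul (uP 1%N) (yP k)) _ => c j /=.
  exact: shear_translate_ey.
- move=> k; apply: realised_eq (realised_mul (xP k) wP)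
    (realised_mul wP (yP k)) _ => c j /=.
  by rewrite /swap /translate flipD; congr (_ + _); rewrite /delta; case: ifP.
- move=> k; apply: realised_eq (realised_mul (yP k) wP)
    (realised_mul wP (xP k)) _ => c j /=.
  by rewrite /swap /translate flipD; congr (_ + _); rewrite /delta; case: ifP.
Qed.

End ShearGroup.

Lemma scale_group_not_haagerup (R : realType) (m : nat) (V : choiceType)
    (e : rel V) (w : set (nat -> V)) :
  regular_tree e (4 * m.+1).+1 -> is_end e w ->
  exists H : set (aut e),
    [/\ is_subgroup H /\ H `<=` aut_end w, countable H, ~ haagerup R H,
        vertex_transitive H & scale_group (closure H)].
Proof.
move=> reg wend; have [tree _] := reg.
have [par [r [par_r epar meet par_inj wE]]] := end_parent tree wend.
pose L := (bool * bool * 'I_m.+1)%type.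
have cardL : #|{: L}| = (4 * m.+1)%N by rewrite !card_prod card_bool card_ord.
have [|lab [ht [lab_inj lab_surj lab_r ht_par ht_r0]]] :=
    @horocyclic_labelling V L par r par_r meet par_inj.
  move=> x; apply: (children_labelling (e := e)) => //.
  - exact: (0 : L).
  - by rewrite cardL.
  - by apply/eqP => /(par_inj x 2 0).
have [H [sH cH Hpar tH nH]] :=
  shear_group_exists par_r epar meet lab_inj lab_surj lab_r ht_par ht_r0.
exists H; split=> //; rewrite ?wE in wend *.
  by split=> //; apply: subset_trans Hpar (@par_stabilizer_end _ _ par).
exact: scale_group_closure Hpar wend.
Qed.

Theorem theorem7p5 (R : realType) :
  (forall (V : choiceType) (e : rel V) (w : set (nat -> V)),
     regular_tree e 9 -> is_end e w ->
     exists H : set (aut e),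
       [/\ is_subgroup H /\ H `<=` aut_end w,
           countable H,
           ~ haagerup R H,
           vertex_transitive H
         & scale_group (closure H)]) /\
  (forall (V : choiceType) (e : rel V) (w : set (nat -> V)),
     regular_tree e 5 -> is_end e w ->
     exists H : set (aut e),
       [/\ is_subgroup H /\ H `<=` aut_end w,
           countable H,
           ~ haagerup R H,
           vertex_transitive H
         & scale_group (closure H)]).
Proof.
(* The degrees are 9 = 4 * 2 + 1 and 5 = 4 * 1 + 1, with label groups of order 8 and 4. *)
split=> V e w; first exact: (@scale_group_not_haagerup R 1).
exact: (@scale_group_not_haagerup R 0).
Qed.
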